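(* Let $n>1$ be an integer, let $a_k>0$ and $c_k,d_k,\beta_k\in\mathbb R$ ($k=1,\dots,n$) with $\sum_{k=1}^n a_k=1$, and suppose that the similarity operator $G$ with these parameters is contractive (in $L_p[0,1]$ for some $p\in[1,+\infty]$). Then the function $f$ defined by $G$, i.e. its fixed point $f=G(f)$, is a continuous function on $[0,1]$ (has a continuous representative) if and only if $$\max_{1\le k\le n}|d_k|<1$$ and there are real numbers, denoted $f(0)$ and $f(1)$ (the values of $f$ at the endpoints), such that $$\beta_1=f(0)(1-d_1),$$ $$\beta_k=\sum_{j=1}^{k-1}c_j+f(1)\sum_{j=1}^{k-1}d_j+f(0)\Big(1-\sum_{j=1}^{k}d_j\Big),\qquad k=2,3,\dots,n,$$ $$\sum_{j=1}^n c_j+(f(1)-f(0))\sum_{j=1}^n d_j=f(1)-f(0).$$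
   Context: Set $\alpha_1=0$ and $\alpha_k=\sum_{l=1}^{k-1}a_l$ for $k=2,\dots,n+1$, so that $0=\alpha_1<\alpha_2<\dots<\alpha_{n+1}=1$. The similarity operator $G$ with parameters $\{a_k\},\{c_k\},\{d_k\},\{\beta_k\}$ acts on $L_p[0,1]$ by $$G(f)(x)=c_k\,t+d_k\,f(t)+\beta_k,\qquad x=a_kt+\alpha_k\in(\alpha_k,\alpha_{k+1}),\quad t\in(0,1),\quad k=1,\dots,n.$$ $G$ is contractive in $L_p[0,1]$ if there is $q<1$ with $\|G(f_1)-G(f_2)\|_{L_p}\le q\|f_1-f_2\|_{L_p}$ for all $f_1,f_2\in L_p[0,1]$; this is equivalent to $\sum_{k=1}^n a_k|d_k|^p<1$ when $1\le p<+\infty$ and to $\max_{1\le k\le n}|d_k|<1$ when $p=+\infty$. In that case $G$ has a unique fixed point $f\in L_p[0,1]$, $G(f)=f$.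
   Formalization: For p < +∞ the fixed point f is additionally assumed not to be a.e. equal to an affine function; otherwise the claim max|d_k| < 1 can fail (n=2, p=1, a_1=a_2=1/2, d_1=1, d_2=0, c=β=0, f=0). *)

(* Defs.v *)
From HB Require Import structures.
From mathcomp Require Export all_boot all_order all_algebra.
From mathcomp Require Export all_classical all_reals all_analysis.

Set Implicit Arguments.
Unset Strict Implicit.
Unset Printing Implicit Defensive.

Export Order.TTheory GRing.Theory Num.Theory.
Export numFieldNormedType.Exports.

Local Open Scope classical_set_scope.
Local Open Scope ring_scope.

(* L_p[0,1] is the space of Borel functions R -> R with finite L_p-norm for the
   restriction of Lebesgue measure to [0,1], taken up to equality almost
   everywhere for this measure; values outside [0,1] are irrelevant. *)
Definition lebesgue01 (R : realType) : {measure set (measurableTypeR R) -> \bar R} :=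
  mrestr (@lebesgue_measure R) (measurable_itv `[0 : R, 1 : R]).

Section SimilarityOperator.
Context {R : realType} {n : nat}.
Implicit Types (a c d beta : 'I_n -> R) (f g : R -> R).

(* The indices 1, ..., n of the parameters are shifted to 0, ..., n-1, so that
   [alpha a k] is $\alpha_{k+1}$, for k = 0, ..., n. *)
Definition alpha a (k : nat) : R := \sum_(l < n | (l < k)%N) a l.

(* The intervals are pairwise disjoint, so the sum has at most one term; the
   value is 0 on the null set of points of [0,1] in none of them. *)
Definition similarity_op a c d beta f (x : R) : R :=
  \sum_(k < n | alpha a k < x < alpha a k.+1)
    (let t := (x - alpha a k) / a k in c k * t + d k * f t + beta k).

Definition contractive (p : \bar R) (G : (R -> R) -> (R -> R)) : Prop :=
  exists2 q : R, q < 1 &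
    forall f1 f2, f1 \in Lfun (lebesgue01 R) p -> f2 \in Lfun (lebesgue01 R) p ->
      ('N[lebesgue01 R]_p[EFin \o (G f1 \- G f2)%R] <=
       q%:E * 'N[lebesgue01 R]_p[EFin \o (f1 \- f2)%R])%E.

Definition is_fixed_point (p : \bar R) (G : (R -> R) -> (R -> R)) f : Prop :=
  f \in Lfun (lebesgue01 R) p /\ {ae lebesgue01 R, forall x, G f x = f x}.

Definition continuous_representative f g : Prop :=
  {within `[0, 1], continuous g} /\ {ae lebesgue01 R, forall x, f x = g x}.

(* If f is affine on [0,1], then G f = f holds as soon as c_k and beta_k are
   chosen accordingly, whatever d_k is. For p < +oo, contractivity only bounds
   sum_k a_k |d_k|^p, so it does not exclude |d_k| >= 1 for such an f: with
   p = 1, a_1 = a_2 = 1/2, d_1 = 1, d_2 = 0 and c = beta = 0, the fixed point 0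
   is continuous although max_k |d_k| = 1. *)
Definition is_affine f : Prop :=
  exists A B : R, {ae lebesgue01 R, forall x, f x = A * x + B}.

Definition endpoint_equations c d beta (f0 f1 : R) : Prop :=
  [/\ forall k : 'I_n, k = 0%N :> nat -> beta k = f0 * (1 - d k),
      forall k : 'I_n, (0 < k)%N ->
        beta k = \sum_(j < n | (j < k)%N) c j
                 + f1 * (\sum_(j < n | (j < k)%N) d j)
                 + f0 * (1 - \sum_(j < n | (j <= k)%N) d j)
    & \sum_(j < n) c j + (f1 - f0) * (\sum_(j < n) d j) = f1 - f0].

End SimilarityOperator.

(* Main.v *)
Require Import Defs.
From mathcomp Require Import measurable_realfun ess_sup_inf ring lra.

(** If f has a continuous representative g, the fixed-point equation, pulled back by
    the affine maps S_k t = a_k t + alpha_k (which preserve null sets), gives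
    g (S_k t) = c_k t + d_k g t + beta_k, first for almost every t, then for all t
    in [0,1] by continuity; matching the values at t = 0 and t = 1 across the points
    alpha_k and telescoping gives the endpoint equations. If |d_k| >= 1, iterating
    S_k at its fixed point forces g to coincide with its chord, hence to be affine;
    for p = +oo, comparing G 1 with G 0 gives |d_k| < 1 directly.
    Conversely, the endpoint equations make the branches of G match at the alpha_k
    on functions with endpoint values f0 and f1, so that Picard iteration converges
    uniformly to a continuous fixed point, which equals f almost everywhere since G
    is a contraction of L_p. *)

Set Implicit Arguments.
Unset Strict Implicit.
Unset Printing Implicit Defensive.

Local Open Scope classical_set_scope.
Local Open Scope ring_scope.

(* Without this instance [filterS] fails on [lebesgue01]: the generic hint does not
   see through the coercion of [measurableTypeR R]. *)
#[local] Instance ae_lebesgue01_filter (R : realType) :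
  Filter (almost_everywhere (lebesgue01 R)) := ae_filter_ringOfSetsType (lebesgue01 R).

(** * Null sets of [[0, 1]] and their behaviour under affine maps *)

Section Lebesgue01.
Context {R : realType}.
Local Notation mu := (@lebesgue_measure R).

(** The restricted measure ignores the complement of [[0, 1]]: an exceptional set may be cut down to
    [[0, 1]] in one direction and enlarged by the complement in the other. *)
Lemma ae_lebesgue01P (P : R -> Prop) :
  {ae lebesgue01 R, forall x, P x} <-> mu.-negligible [set x | 0 <= x <= 1 /\ ~ P x].
Proof.
split=> [[N [mN N0 PN]]|[N [mN N0 PN]]].
  exists (N `&` `[0, 1]%classic); split.
  - exact: measurableI.
  - exact: N0.
  - move=> x /= [x01 nP]; split; first exact: PN.
    by rewrite /= in_itv.
exists (N `|` ~` `[0, 1]%classic); split.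
- apply: measurableU => //; exact: measurableC.
- rewrite /lebesgue01 /= /mrestr setIUl setICl setU0.
  by apply/eqP; rewrite eq_le measure_ge0 andbT -N0; apply: le_measure;
    rewrite ?inE//; exact: measurableI.
- move=> x nP; case: (pselect (`[0, 1]%classic x)) => x01; [left|by right].
  by apply: PN; split => //; rewrite /= in_itv in x01.
Qed.

Lemma ae_lebesgue01_mem : {ae lebesgue01 R, forall x, 0 <= x <= 1}.
Proof.
by apply/ae_lebesgue01P; apply: negligibleS (negligible_set0 _) => x [].
Qed.

Lemma lebesgue_measure_affine_preimage (a b : R) (A : set (measurableTypeR R)) :
  0 < a -> measurable A ->
  mu [set t | A (a * t + b)] = ((a^-1)%:E * mu A)%E.
Proof.
move=> a0 mA.
pose h (x : measurableTypeR R) : measurableTypeR R := a * x + b.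
have mh : measurable_fun setT h.
  apply: continuous_measurable_fun => x.
  by apply: cvgD; [apply: cvgM; [exact: cvg_cst|exact: cvg_id]|exact: cvg_cst].
(* [nu] is [a] times the image of [mu] under [h]. It gives each half-open interval its length, so
   uniqueness of Lebesgue measure identifies it with [mu]. *)
pose nu : {measure set (measurableTypeR R) -> \bar R} :=
  mscale (NngNum (ltW a0))
    (measure_function_pushforward__canonical__measure_function_Measure mu mh).
have nuE B : nu B = (a%:E * mu (h @^-1` B))%E by [].
have muE : forall B, measurable B -> mu B = nu B.
  apply: lebesgue_measure_unique => _ [[u v] _ <-].
  rewrite nuE (_ : h @^-1` _ = `](u - b) / a, (v - b) / a]%classic); last first.
    apply/seteqP; split=> x /=; rewrite !in_itv/= /h;
      by rewrite ltr_pdivrMr// ler_pdivlMr// ltrBlDr lerBrDr (mulrC x).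
  rewrite !lebesgue_measure_itv/= !lte_fin ltr_pM2r ?invr_gt0// ltrD2r.
  case: ifP => uv; last by rewrite mule0.
  rewrite -!EFinB -EFinM; congr EFin.
  by field; rewrite gt_eqF.
by rewrite (muE A mA) nuE muleA -EFinM mulVf ?gt_eqF// mul1e.
Qed.

(** The preimage of a null set has measure [a^-1] times zero; the bounds on [b] and [a + b] keep the
    image of [[0, 1]] inside [[0, 1]]. *)
Lemma ae_lebesgue01_affine (P : R -> Prop) (a b : R) :
  0 < a -> 0 <= b -> a + b <= 1 ->
  {ae lebesgue01 R, forall x, P x} -> {ae lebesgue01 R, forall t, P (a * t + b)}.
Proof.
move=> a0 b0 ab1 /ae_lebesgue01P [N [mN N0 PN]].
apply/ae_lebesgue01P; exists [set t | N (a * t + b)]; split.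
- have mh : measurable_fun setT (fun x : measurableTypeR R => a * x + b : measurableTypeR R).
    apply: continuous_measurable_fun => x.
    by apply: cvgD; [apply: cvgM; [exact: cvg_cst|exact: cvg_id]|exact: cvg_cst].
  by rewrite -[X in measurable X]setTI; exact: mh.
- by rewrite lebesgue_measure_affine_preimage// [mu N]N0 mule0.
- by move=> t /= [t01 nP]; apply: PN; split => //; nra.
Qed.

Lemma ae_lebesgue01_dense (P : R -> Prop) (u v : R) :
  0 <= u -> u < v -> v <= 1 -> {ae lebesgue01 R, forall x, P x} ->
  exists x, u < x < v /\ P x.
Proof.
move=> u0 uv v1 /ae_lebesgue01P [N [mN N0 PN]].
apply: contrapT => nex.
have sub : `]u, v[%classic `<=` N.
  move=> x; rewrite /= in_itv/= => uxv; apply: PN; split; first lra.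
  by move=> Px; apply: nex; exists x.
have : (mu `]u, v[%classic <= mu N)%E by apply: le_measure; rewrite ?inE.
by rewrite [mu N]N0 lebesgue_measure_itv/= lte_fin uv -EFinB lee_fin; lra.
Qed.

End Lebesgue01.

(** * Extending continuous functions from [[0, 1]] to the line *)

Section Clamp.
Context {R : realType}.

(** Retraction of the line onto [[0, 1]]. Composing with it trades continuity within [[0, 1]] for
    continuity everywhere. *)
Definition clamp01 (x : R) : R := Num.max 0 (Num.min x 1).

Lemma clamp01_itv x : 0 <= clamp01 x <= 1.
Proof. by rewrite /clamp01; case: (ltrP x 1) => ?; [case: (ltrP 0 x)|case: (ltrP 0 1)]; lra. Qed.

Lemma clamp01_id x : 0 <= x <= 1 -> clamp01 x = x.
Proof. by rewrite /clamp01; case: (ltrP x 1) => ?; [case: (ltrP 0 x)|case: (ltrP 0 1)]; lra. Qed.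

Lemma clamp01_le0 x : x <= 0 -> clamp01 x = 0.
Proof. by rewrite /clamp01; case: (ltrP x 1) => ?; [case: (ltrP 0 x)|case: (ltrP 0 1)]; lra. Qed.

Lemma clamp01_ge1 x : 1 <= x -> clamp01 x = 1.
Proof. by rewrite /clamp01; case: (ltrP x 1) => ?; [case: (ltrP 0 x)|case: (ltrP 0 1)]; lra. Qed.

Lemma continuous_clamp01 : continuous clamp01.
Proof.
move=> x.
have c0 : {for x, continuous (cst 0 : R -> R^o)} by exact: cst_continuous.
have c1 : {for x, continuous (cst 1 : R -> R^o)} by exact: cst_continuous.
have ci : {for x, continuous (id : R -> R^o)} by exact: cvg_id.
exact: (continuous_max c0 (continuous_min ci c1)).
Qed.

Lemma continuous_comp_clamp01 (g : R -> R) :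
  {within `[0, 1], continuous g} -> continuous (g \o clamp01).
Proof.
move=> /subspace_continuousP cg x.
have /cg cgx : `[0, 1]%classic (clamp01 x) by rewrite /= in_itv/= clamp01_itv.
apply: (@cvg_comp _ _ _ clamp01 g _ _ _ _ cgx) => B /= wB.
have cB : nbhs x (fun y => `[0, 1]%classic (clamp01 y) -> B (clamp01 y)).
  exact: (@continuous_clamp01 x _ wB).
have sub y : (`[0, 1]%classic (clamp01 y) -> B (clamp01 y)) -> B (clamp01 y).
  by apply; rewrite /= in_itv; exact: clamp01_itv.
exact: filterS sub cB.
Qed.

Lemma continuous_ae_eq01 (g h : R -> R) : continuous g -> continuous h ->
  {ae lebesgue01 R, forall x, 0 < x < 1 -> g x = h x} ->
  forall x, 0 <= x <= 1 -> g x = h x.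
Proof.
move=> cg ch gh x x01; apply/eqP; rewrite -subr_eq0 -normr_le0.
apply/ler_addgt0Pl => e e0; rewrite addr0.
have : (fun y => g y - h y) y @[y --> x] --> g x - h x by apply: cvgB; [exact: cg|exact: ch].
move=> /cvgr_dist_le /(_ _ e0) /nbhs_ballP [r /= r0 xr].
(* The truncated neighbourhood of [x] is a nonempty open interval inside [(0, 1)] even when [x] is
   an endpoint, so it contains a point where [g] and [h] agree. *)
have [y [yr /(_ _)]] : exists y, Num.max 0 (x - r) < y < Num.min 1 (x + r) /\
    (0 < y < 1 -> g y = h y).
  apply: ae_lebesgue01_dense gh.
  - by rewrite le_max lexx.
  - by rewrite gt_max !lt_min; lra.
  - by rewrite ge_min lexx.
move: yr; rewrite gt_max lt_min => /andP[/andP[y0 xy] /andP[y1 yx]] ghy.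
have := xr y; rewrite /ball/= ghy ?y0// subrr subr0; apply.
by rewrite ltr_norml; lra.
Qed.

End Clamp.

(** * The partition of [[0, 1]] and the branches of the operator *)

Section Alpha.
Context {R : realType} {n : nat}.
Implicit Types a u : 'I_n -> R.

Lemma alpha0 u : alpha u 0 = 0.
Proof. by rewrite /alpha big_pred0. Qed.

Lemma alphaS u (k : 'I_n) : alpha u k.+1 = alpha u k + u k.
Proof.
rewrite /alpha (bigD1 k) ?ltnSn//= addrC; congr (_ + _).
by apply: eq_bigl => j; rewrite ltnS [in RHS]ltn_neqAle andbC.
Qed.

Lemma alpha_full u : alpha u n = \sum_(k < n) u k.
Proof. by apply: eq_bigl => j; rewrite ltn_ord. Qed.

Lemma alpha_le a (i j : nat) : (forall k, 0 < a k) -> (i <= j)%N ->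
  alpha a i <= alpha a j.
Proof.
move=> a0 ij; rewrite /alpha [leLHS]big_mkcond [leRHS]big_mkcond/=.
apply: ler_sum => k _; case: ifP => ki; last by case: ifP => // _; exact: ltW.
by rewrite (leq_trans ki ij).
Qed.

Context (a : 'I_n -> R) (a_gt0 : forall k, 0 < a k) (a_sum1 : \sum_(k < n) a k = 1).

Lemma alpha_ge0 k : 0 <= alpha a k.
Proof. by rewrite -(alpha0 a) alpha_le. Qed.

Lemma alphaS_le1 (k : 'I_n) : a k + alpha a k <= 1.
Proof. by rewrite addrC -alphaS -a_sum1 -alpha_full alpha_le. Qed.

Lemma alpha_itv_inj (j k : 'I_n) x :
  alpha a j < x < alpha a j.+1 -> alpha a k < x < alpha a k.+1 -> j = k.
Proof.
move=> /andP[jx xj] /andP[kx xk]; apply/val_inj => /=.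
case: (ltngtP j k) => // jk.
- by exfalso; have := alpha_le a_gt0 jk; lra.
- by exfalso; have := alpha_le a_gt0 jk; lra.
Qed.

Lemma alpha_itv_cover x : 0 <= x <= 1 -> (forall k, (k <= n)%N -> x != alpha a k) ->
  exists k : 'I_n, alpha a k < x < alpha a k.+1.
Proof.
move=> /andP[x0 x1] xa.
(* Descending from [m = n], where [alpha a n = 1], the induction finds the first partition point
   beyond [x]. *)
suff H m : (m <= n)%N -> x < alpha a m -> exists k : 'I_n, alpha a k < x < alpha a k.+1.
  by apply: H (leqnn n) _; rewrite lt_neqAle xa//= alpha_full a_sum1.
elim: m => [_|m IH mn]; first by rewrite alpha0; lra.
move=> xm; case: (ltrP x (alpha a m)) => [|mx]; first by apply: IH; exact: ltnW.
by exists (Ordinal mn); rewrite /= xm andbT lt_neqAle mx eq_sym xa// ltnW.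
Qed.

Lemma similarity_op_affine c d beta (u : R -> R) (k : 'I_n) t : 0 < t < 1 ->
  similarity_op a c d beta u (a k * t + alpha a k) = c k * t + d k * u t + beta k.
Proof.
move=> t01; have ak := a_gt0 k.
have xk : alpha a k < a k * t + alpha a k < alpha a k.+1 by rewrite alphaS; nra.
rewrite /similarity_op (big_pred1 k) => [|j].
  by rewrite addrK mulrAC divff ?gt_eqF// mul1r.
by apply/idP/eqP => [jx|->//]; exact: alpha_itv_inj jx xk.
Qed.

Lemma ae_mem_alpha_itv :
  {ae lebesgue01 R, forall x, exists k : 'I_n, alpha a k < x < alpha a k.+1}.
Proof.
have cA : countable [set alpha a k | k in `I_n.+1].
  by apply: finite_set_countable; apply: finite_image; exact: finite_II.
apply/ae_lebesgue01P; exists [set alpha a k | k in `I_n.+1]; split.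
- by apply: countable_measurable => //; exact: measurable_set1.
- exact: countable_lebesgue_measure0.
- move=> x /= [x01 nx]; apply: contrapT => xa; apply: nx.
  apply: alpha_itv_cover => // k kn; apply/eqP => xk; apply: xa.
  by exists k.
Qed.

Lemma ae_fixed_affine c d beta (f : R -> R) :
  {ae lebesgue01 R, forall x, similarity_op a c d beta f x = f x} ->
  forall k, {ae lebesgue01 R, forall t, 0 < t < 1 ->
    f (a k * t + alpha a k) = c k * t + d k * f t + beta k}.
Proof.
move=> Gf k.
have := ae_lebesgue01_affine (a_gt0 k) (alpha_ge0 k) (alphaS_le1 k) Gf.
by apply: filterS => t <- t01; rewrite similarity_op_affine.
Qed.

Lemma continuous_fixed_affine c d beta (f g : R -> R) :
  {ae lebesgue01 R, forall x, similarity_op a c d beta f x = f x} ->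
  continuous g -> {ae lebesgue01 R, forall x, f x = g x} ->
  forall k t, 0 <= t <= 1 -> g (a k * t + alpha a k) = c k * t + d k * g t + beta k.
Proof.
move=> Gf cg fg k.
have fgk := ae_lebesgue01_affine (a_gt0 k) (alpha_ge0 k) (alphaS_le1 k) fg.
apply: continuous_ae_eq01.
- move=> t; apply: continuous_comp; last exact: cg.
  by apply: cvgD; [apply: cvgM; [exact: cvg_cst|exact: cvg_id]|exact: cvg_cst].
- move=> t; apply: cvgD; last exact: cvg_cst.
  by apply: cvgD; apply: cvgM; [exact: cvg_cst|exact: cvg_id|exact: cvg_cst|exact: cg].
- apply: filterS3 (ae_fixed_affine Gf k) fg fgk => t /= ft <- <-.
  exact: ft.
Qed.

(** Each [alpha a k] with [0 < k < n] is the image of [1] under one branch and of [0] under the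
    next. The two resulting expressions for [g] there yield the equations for [beta], and
    [alpha a n = 1] yields the last one. *)
Lemma endpoint_equations_affine c d beta (g : R -> R) : (0 < n)%N ->
  (forall k t, 0 <= t <= 1 -> g (a k * t + alpha a k) = c k * t + d k * g t + beta k) ->
  endpoint_equations c d beta (g 0) (g 1).
Proof.
move=> n0 gE.
have g0 (k : 'I_n) : g (alpha a k) = d k * g 0 + beta k.
  by have := gE k 0; rewrite lexx ler01 !mulr0 !add0r; apply.
have g1 (k : 'I_n) : g (alpha a k.+1) = c k + d k * g 1 + beta k.
  by have := gE k 1; rewrite lexx ler01 !mulr1 alphaS (addrC (a k)); apply.
(* Here [alpha] also denotes the partial sums of [c] and [d]. Subtracting [g0] from [g1] eliminates
   [beta] and leaves the increment of [g] over one interval, which telescopes. *)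
have gS m : (m <= n)%N -> g (alpha a m) = g 0 + alpha c m + (g 1 - g 0) * alpha d m.
  elim: m => [_|m IH mn]; first by rewrite !alpha0 mulr0 !addr0.
  have := g0 (Ordinal mn); have := g1 (Ordinal mn); rewrite /= IH 1?ltnW// => -> e.
  have := alphaS c (Ordinal mn); have := alphaS d (Ordinal mn) => /= -> ->.
  by rewrite mulrDr; lra.
split.
- by move=> k k0; have := g0 k; rewrite k0 alpha0; lra.
- move=> k _; rewrite -/(alpha c k) -/(alpha d k) -/(alpha d k.+1) alphaS.
  by have := g0 k; rewrite gS; [lra|exact: ltnW].
- have := gS n (leqnn n); rewrite !alpha_full a_sum1; lra.
Qed.

End Alpha.

(** * Rigidity of a branch with [|d| >= 1] *)

Section ChordDefect.
Context {R : realType}.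

(* The defect of g from its chord is multiplied by d under t |-> a t + b, and the
   iterates of this map shrink [0,1] to the point b / (1 - a), where g is continuous. *)
Lemma affine_of_scaling_ge1 (a b c d beta : R) (g : R -> R) :
  0 < a -> a < 1 -> 0 <= b -> a + b <= 1 -> continuous g ->
  (forall t, 0 <= t <= 1 -> g (a * t + b) = c * t + d * g t + beta) ->
  1 <= `|d| ->
  forall t, 0 <= t <= 1 -> g t = (g 1 - g 0) * t + g 0.
Proof.
move=> a0 a1 b0 ab1 cg gE d1 t t01.
pose x0 := b / (1 - a).
have x0E : a * x0 + b = x0 by rewrite /x0; field; lra.
pose y s m := x0 + a ^+ m * (s - x0).
have yS s m : y s m.+1 = a * y s m + b by rewrite /y exprS -{1}x0E; ring.
have y01 s m : 0 <= s <= 1 -> 0 <= y s m <= 1.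
  move=> s01; elim: m => [|m IH]; first by rewrite /y expr0 mul1r addrC subrK.
  by rewrite yS; nra.
pose D m := g (y t m) - (1 - t) * g (y 0 m) - t * g (y 1 m).
have D0 : D 0%N = g t - (1 - t) * g 0 - t * g 1.
  by rewrite /D /y !expr0 !mul1r ![x0 + _]addrC !subrK.
have DE m : D m = d ^+ m * D 0%N.
  elim: m => [|m IH]; first by rewrite expr0 mul1r.
  rewrite exprS -mulrA -IH /D !yS !gE ?y01 ?lexx ?ler01//.
  by rewrite /y; ring.
have cy s : g (y s m) @[m --> \oo] --> g x0.
  apply: continuous_cvg; first exact: cg.
  rewrite -[X in _ --> X]addr0 -[X in _ --> _ + X](mul0r (s - x0)).
  apply: cvgD; first exact: cvg_cst.
  apply: cvgM; last exact: cvg_cst.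
  by apply: cvg_expr; rewrite ger0_norm// ltW.
have cD : D m @[m --> \oo] --> 0.
  have -> : 0 = g x0 - (1 - t) * g x0 - t * g x0 by ring.
  apply: cvgB; first apply: cvgB; first exact: cy.
  - by apply: cvgM; [exact: cvg_cst|exact: cy].
  - by apply: cvgM; [exact: cvg_cst|exact: cy].
(* Since [|d| ^+ m >= 1], the norm of [D 0] is at most that of [D m], which tends to [0]. *)
suff : D 0%N = 0 by rewrite D0; lra.
apply/eqP; rewrite -normr_le0; apply/ler_addgt0Pl => e e0; rewrite addr0.
have /cvgr_dist_le /(_ _ e0) [m _ /(_ m (leqnn m))] := cD.
rewrite /= sub0r normrN DE normrM normrX; apply: le_trans.
by rewrite ler_peMl// exprn_ege1.
Qed.

End ChordDefect.

(** * Uniform convergence with geometric increments *)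

Section GeometricLimit.
Context {R : realType}.

(** Weierstrass test. The explicit rate is kept because its case [m = 0] later shows that the limit
    is bounded. *)
Lemma geometric_uniform_limit (u : nat -> R -> R) (M q : R) :
  0 <= q < 1 -> (forall m, continuous (u m)) ->
  (forall m x, `|u m.+1 x - u m x| <= M * q ^+ m) ->
  exists g : R -> R, [/\ continuous g, forall x, u m x @[m --> \oo] --> g x &
    forall m x, `|g x - u m x| <= M / (1 - q) * q ^+ m].
Proof.
move=> /andP[q0 q1] cu du.
pose B m := M / (1 - q) * q ^+ m.
have cB : B m @[m --> \oo] --> 0 by apply: cvg_geometric; rewrite ger0_norm.
have M0 : 0 <= M by have := du 0%N 0; rewrite expr0 mulr1; apply: le_trans.
(* The right-hand side is the exact sum of [M * q ^+ i] for [m <= i < m + k], which lets the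
   induction close. *)
have uB m k x : `|u (m + k)%N x - u m x| <= B m * (1 - q ^+ k).
  elim: k => [|k IH]; first by rewrite addn0 subrr normr0 expr0 subrr mulr0.
  have := ler_normD (u (m + k).+1 x - u (m + k)%N x) (u (m + k)%N x - u m x).
  rewrite addrA subrK addnS => /le_trans; apply.
  apply: le_trans (lerD (du _ _) IH) _.
  rewrite le_eqVlt; apply/orP; left; apply/eqP.
  by rewrite /B exprD exprS; field; lra.
have uB' m k x : `|u (m + k)%N x - u m x| <= B m.
  apply: le_trans (uB m k x) _; rewrite ler_piMr ?gerBl ?exprn_ge0//.
  by rewrite /B mulr_ge0 ?exprn_ge0// divr_ge0//; lra.
have uc x : cvgn (u ^~ x).
  apply/cauchy_cvgP; apply: cauchy_exP => e e0.
  have /cvgr_dist_lt /(_ _ e0) [m _ /(_ m (leqnn m))] := cB.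
  rewrite /= sub0r normrN => Bm.
  exists (u m x); exists m => // k /= mk; rewrite /ball/= distrC.
  rewrite -(subnKC mk) (le_lt_trans (uB' _ _ _))//.
  exact: le_lt_trans (ler_norm _) Bm.
have gB m y : `|limn (u ^~ y) - u m y| <= B m.
  have : (fun k => `|u (m + k)%N y - u m y|) @ \oo --> `|limn (u ^~ y) - u m y|.
    apply: cvg_norm; apply: cvgB; last exact: cvg_cst.
    exact: (cvg_comp (addn m) (u ^~ y) (@cvg_addnl m) (uc y)).
  move=> h; rewrite -(cvg_lim _ h)//; apply: limr_le; first by apply/cvgP: h.
  exact: nearW.
exists (fun x => limn (u ^~ x)); split => // x.
apply/cvgrPdist_le => e e0.
have e3 : 0 < e / 3 by lra.
have /cvgr_dist_le /(_ _ e3) [m _ /(_ m (leqnn m))] := cB.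
rewrite /= sub0r normrN => /(le_trans (ler_norm _)) Bm.
have /cvgr_dist_le /(_ _ e3) := cu m x.
apply: filterS => y uy.
have := le_trans (gB m x) Bm; have := le_trans (gB m y) Bm.
by rewrite !ler_norml in uy *; lra.
Qed.

End GeometricLimit.

(** * Construction of a continuous fixed point from the endpoint equations *)

Section Picard.
Context {R : realType} {n : nat} (a c d beta : 'I_n -> R) (f0 f1 : R).
Hypotheses (a_gt0 : forall k, 0 < a k) (a_sum1 : \sum_(k < n) a k = 1).
Implicit Types u v : R -> R.

Definition rescale01 (k : 'I_n) (x : R) := clamp01 ((x - alpha a k) / a k).

(* For u with endpoint values f0 and f1 this is G u, in a form that is visibly
   continuous: the branches left of x are frozen at t = 1, those right of x at t = 0. *)
Definition glued_op u x :=
  f0 + \sum_(k < n) (c k * rescale01 k x + d k * (u (rescale01 k x) - f0)).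

Lemma rescale01_le (k : 'I_n) x : x <= alpha a k -> rescale01 k x = 0.
Proof. by move=> xk; apply: clamp01_le0; rewrite pmulr_lle0 ?invr_gt0// subr_le0. Qed.

Lemma rescale01_ge (k : 'I_n) x : alpha a k.+1 <= x -> rescale01 k x = 1.
Proof.
move=> kx; apply: clamp01_ge1; rewrite ler_pdivlMr// mul1r.
by move: kx; rewrite alphaS; lra.
Qed.

Lemma rescale01_in (k : 'I_n) x : alpha a k < x < alpha a k.+1 ->
  rescale01 k x = (x - alpha a k) / a k.
Proof.
rewrite alphaS => /andP[kx xk]; apply: clamp01_id.
by rewrite ler_pdivlMr// ler_pdivrMr// mul0r mul1r; lra.
Qed.

Lemma continuous_rescale01 k : continuous (rescale01 k).
Proof.
move=> x; apply: (@continuous_comp _ _ _ (fun x => (x - alpha a k) / a k) clamp01).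
  by apply: cvgM; [apply: cvgB; [exact: cvg_id|exact: cvg_cst]|exact: cvg_cst].
exact: continuous_clamp01.
Qed.

Lemma continuous_glued_op u : continuous u -> continuous (glued_op u).
Proof.
move=> cu x; apply: cvgD; first exact: cvg_cst.
apply: cvg_big => [|k _]; first exact: add_continuous.
apply: cvgD; apply: cvgM.
- exact: cvg_cst.
- exact: continuous_rescale01.
- exact: cvg_cst.
- apply: cvgB; last exact: cvg_cst.
  by apply: continuous_comp; [exact: continuous_rescale01|exact: cu].
Qed.

Lemma glued_op_cvg (w : nat -> R -> R) u x :
  (forall y, w m y @[m --> \oo] --> u y) ->
  glued_op (w m) x @[m --> \oo] --> glued_op u x.
Proof.
move=> wu; apply: cvgD; first exact: cvg_cst.
apply: cvg_big => [|k _]; first exact: add_continuous.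
apply: cvgD; first exact: cvg_cst.
apply: cvgM; first exact: cvg_cst.
by apply: cvgB; [exact: wu|exact: cvg_cst].
Qed.

Lemma glued_op_bounded u B : (forall x, `|u x| <= B) ->
  forall x, `|glued_op u x| <= `|f0| + \sum_(k < n) (`|c k| + `|d k| * (B + `|f0|)).
Proof.
move=> uB x; apply: le_trans (ler_normD _ _) _; rewrite lerD2l.
apply: le_trans (ler_norm_sum _ _ _) _; apply: ler_sum => k _.
apply: le_trans (ler_normD _ _) _; rewrite !normrM; apply: lerD.
  have /andP[h0 h1] := clamp01_itv ((x - alpha a k) / a k).
  by rewrite ler_piMr// ger0_norm.
by rewrite ler_wpM2l// (le_trans (ler_normB _ _))// lerD2r.
Qed.

(** Outside its own interval the [k]-th term sees only [u] and [v] at [0] or [1], where they agree.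
    At most one term of the difference survives, so the rate is a bound on the single [|d k|] and
    not on their sum. *)
Lemma glued_op_contract u v (B q : R) :
  u 0 = v 0 -> u 1 = v 1 -> (forall k, `|d k| <= q) ->
  (forall x, `|u x - v x| <= B) -> 0 <= q * B ->
  forall x, `|glued_op u x - glued_op v x| <= q * B.
Proof.
move=> uv0 uv1 dq uvB qB0 x.
have -> : glued_op u x - glued_op v x =
    \sum_(k < n) d k * (u (rescale01 k x) - v (rescale01 k x)).
  rewrite /glued_op opprD addrACA subrr add0r -sumrB.
  by apply: eq_bigr => k _; ring.
have out (k : 'I_n) : ~~ (alpha a k < x < alpha a k.+1) ->
    d k * (u (rescale01 k x) - v (rescale01 k x)) = 0.
  rewrite negb_and -!leNgt => /orP[xk|kx].
    by rewrite rescale01_le// uv0 subrr mulr0.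
  by rewrite rescale01_ge// uv1 subrr mulr0.
case: (pickP (fun k : 'I_n => alpha a k < x < alpha a k.+1)) => [k xk|nx].
  rewrite (bigD1 k)//= big1 => [|j jk].
    by rewrite addr0 normrM ler_pM.
  apply: out; apply: contra jk => xj; apply/eqP.
  exact: (alpha_itv_inj a_gt0 xj xk).
by rewrite big1 ?normr0// => k _; apply: out; rewrite nx.
Qed.

Hypothesis eqs : endpoint_equations c d beta f0 f1.

Lemma endpoint_betaE (k : 'I_n) :
  beta k = alpha c k + f1 * alpha d k + f0 * (1 - alpha d k.+1).
Proof.
case: eqs => e0 eS _; have [k0|] := posnP k; last exact: eS.
by rewrite e0// alphaS k0 !alpha0 mulr0 !add0r.
Qed.

Lemma glued_opE u (k : 'I_n) x : u 0 = f0 -> u 1 = f1 ->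
  alpha a k < x < alpha a k.+1 -> glued_op u x = similarity_op a c d beta u x.
Proof.
move=> u0 u1 xk; have ak := a_gt0 k.
pose t := (x - alpha a k) / a k.
have xE : x = a k * t + alpha a k by rewrite /t; field; rewrite gt_eqF.
have t01 : 0 < t < 1.
  by rewrite /t ltr_pdivlMr// ltr_pdivrMr// mul0r mul1r; move: xk; rewrite alphaS; lra.
rewrite [in RHS]xE similarity_op_affine// /glued_op (bigD1 k)//= rescale01_in// -/t.
(* Branches [j < k] are frozen at [1] and contribute [c j + (f1 - f0) * d j]; branches [j > k] are
   frozen at [0] and contribute nothing. With [f0] and the [k]-th term this adds up to [beta k]. *)
rewrite (_ : \sum_(j < n | j != k) _ = alpha c k + (f1 - f0) * alpha d k).
  by rewrite endpoint_betaE alphaS; ring.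
rewrite /alpha mulr_sumr -big_split/= big_mkcond [RHS]big_mkcond/=.
move/andP: xk => [kx xk]; apply: eq_bigr => j _; rewrite -(inj_eq val_inj)/=.
case: ltngtP => // jk.
  rewrite rescale01_ge ?u1; first ring.
  by apply: le_trans (ltW kx); exact: alpha_le.
rewrite rescale01_le ?u0; first ring.
by apply: le_trans (ltW xk) _; exact: alpha_le.
Qed.

Lemma glued_op0 u : u 0 = f0 -> glued_op u 0 = f0.
Proof.
move=> u0; rewrite /glued_op big1 ?addr0// => k _.
by rewrite rescale01_le ?alpha_ge0// u0 subrr !mulr0 addr0.
Qed.

(** At [1] every branch is frozen at [t = 1], and the last endpoint equation says that the total is
    [f1]. *)
Lemma glued_op1 u : u 1 = f1 -> glued_op u 1 = f1.
Proof.
move=> u1; case: eqs => _ _ e1.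
rewrite /glued_op (eq_bigr (fun k => c k + (f1 - f0) * d k)) => [|k _].
  by rewrite big_split -mulr_sumr/= e1 addrC subrK.
rewrite rescale01_ge ?u1; first by rewrite mulr1 (mulrC (d k)).
by rewrite alphaS addrC alphaS_le1.
Qed.

Lemma exists_continuous_fixed : (forall k, `|d k| < 1) ->
  exists g : R -> R, [/\ continuous g, exists M, forall x, `|g x| <= M,
    g 0 = f0, g 1 = f1 &
    {ae lebesgue01 R, forall x, similarity_op a c d beta g x = g x}].
Proof.
(* The default [0] of the maximum provides [0 <= q]. *)
move=> d1; pose q := \big[Num.max/0]_(k < n) `|d k|.
have q0 : 0 <= q by exact: bigmax_ge_id.
have q1 : q < 1 by apply: bigmax_lt.
have dq k : `|d k| <= q by exact: le_bigmax.
(* The clamped chord is bounded and has the endpoint values [f0] and [f1], which all iterates keep;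
   this agreement at the endpoints is what the contraction estimate requires. *)
pose u0 x := f0 + (f1 - f0) * clamp01 x.
have u0B x : `|u0 x| <= `|f0| + `|f1 - f0|.
  apply: le_trans (ler_normD _ _) _; rewrite lerD2l normrM.
  by have /andP[h0 h1] := clamp01_itv x; rewrite ler_piMr// ger0_norm.
pose w m := iter m glued_op u0.
have cw m : continuous (w m).
  elim: m => [|m IH]; last exact: continuous_glued_op.
  move=> x; apply: cvgD; first exact: cvg_cst.
  by apply: cvgM; [exact: cvg_cst|exact: continuous_clamp01].
have w0 m : w m 0 = f0.
  elim: m => [|m IH]; last exact: glued_op0.
  by rewrite /= /u0 clamp01_le0// mulr0 addr0.
have w1 m : w m 1 = f1.
  elim: m => [|m IH]; last exact: glued_op1.
  by rewrite /= /u0 clamp01_ge1// mulr1 addrC subrK.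
have [M dw0] : exists M, forall x, `|w 1%N x - w 0%N x| <= M.
  eexists => x; apply: le_trans (ler_normB _ _) _.
  by apply: lerD; [exact: glued_op_bounded|exact: u0B].
have M0 : 0 <= M by exact: le_trans (dw0 0).
have dw m x : `|w m.+1 x - w m x| <= M * q ^+ m.
  elim: m x => [|m IH] x; first by rewrite expr0 mulr1.
  rewrite exprS mulrCA; apply: (@glued_op_contract (w m.+1) (w m)) => //.
  - by rewrite !w0.
  - by rewrite !w1.
  - by rewrite !mulr_ge0// exprn_ge0.
have [|g [cg wg gB]] := geometric_uniform_limit _ cw dw; first by rewrite q0.
have g0 : g 0 = f0.
  rewrite -(cvg_lim (@Rhausdorff R) (wg 0)) (_ : w ^~ 0 = cst f0) ?lim_cst//.
  exact/funext.
have g1 : g 1 = f1.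
  rewrite -(cvg_lim (@Rhausdorff R) (wg 1)) (_ : w ^~ 1 = cst f1) ?lim_cst//.
  exact/funext.
have gE x : glued_op g x = g x.
  rewrite -(cvg_lim (@Rhausdorff R) (@glued_op_cvg w g x wg)).
  apply: cvg_lim; first exact: Rhausdorff.
  exact: (cvg_comp (addn 1) (w ^~ x) (@cvg_addnl 1) (wg x)).
exists g; split => //.
- exists (M / (1 - q) + (`|f0| + `|f1 - f0|)) => x.
  rewrite -[g x](subrK (w 0%N x)); apply: le_trans (ler_normD _ _) _.
  by apply: lerD; [have := gB 0%N x; rewrite expr0 mulr1|exact: u0B].
- have := ae_mem_alpha_itv a_sum1; apply: filterS => x [k xk].
  by rewrite -(glued_opE g0 g1 xk) gE.
Qed.

End Picard.

(** * Uniqueness of the fixed point in [L_p] *)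

Section Uniqueness.
Context {R : realType}.

(** A bounded function is in [L_oo], which lies in [L_p] because [lebesgue01] has total mass [1]. *)
Lemma Lfun_bounded01 (p : \bar R) (g : R -> R) (M : R) : (1 <= p)%E ->
  measurable_fun setT (g : measurableTypeR R -> measurableTypeR R) ->
  (forall x, `|g x| <= M) ->
  g \in Lfun (lebesgue01 R) p.
Proof.
move=> p1 mg gM.
have mT : lebesgue01 R setT = 1%E.
  by rewrite /lebesgue01 /= /mrestr setTI lebesgue_measure_itv/= lte_fin ltr01 oppr0 adde0.
apply: (@Lfun_subset _ _ _ (lebesgue01 R) p +oo%E) => //.
- exact: leey.
- by rewrite mT.
- exact: leey.
rewrite inE/=; apply/andP; split; rewrite inE//=.
rewrite /finite_norm unlock /Lnorm; case: ifPn => _; last exact: ltry.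
apply: (@le_lt_trans _ _ M%:E); last exact: ltry.
by apply/ess_supP; apply: nearW => x /=; rewrite lee_fin.
Qed.

Lemma ae_eq_Lnorm d (T : measurableType d) (mu : {measure set T -> \bar R})
    (p : \bar R) (f g : T -> R) : (0 <= p)%E ->
  measurable_fun setT f -> measurable_fun setT g ->
  {ae mu, forall x, f x = g x} ->
  ('N[mu]_p[EFin \o f] = 'N[mu]_p[EFin \o g])%E.
Proof.
move=> p0 mf mg fg; rewrite unlock /Lnorm; case: p p0 => [r r0|_|//].
  have mp (h : T -> R) : measurable_fun setT h ->
      measurable_fun setT (fun x => `|(EFin \o h) x| `^ r)%E.
    move=> /measurable_EFinP mh.
    have mah : measurable_fun setT (abse \o (EFin \o h)) by exact: measurableT_comp.
    have m1 := (measurable_poweR r).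
    exact: (measurableT_comp m1 mah).
  congr poweR; apply: ae_eq_integral => //.
  - exact: mp.
  - exact: mp.
  - by apply: filterS fg => x /= -> .
case: ifP => // _; apply: eq_ess_sup.
by apply: filterS fg => x /= ->.
Qed.

Context {n : nat}.
Implicit Types (a c d beta : 'I_n -> R) (f g : R -> R).

Local Notation RB := (measurableTypeR R).

Lemma measurable_similarity_op a c d beta f :
  measurable_fun setT (f : RB -> RB) ->
  measurable_fun setT (similarity_op a c d beta f : RB -> RB).
Proof.
move=> mf; rewrite /similarity_op.
under eq_fun do rewrite big_mkcond.
apply: measurable_sum => k.
apply: measurable_fun_ifT.
- by apply: measurable_and; apply: measurable_fun_ltr.
- have mt : measurable_fun setT (fun x : RB => (x - alpha a k) / a k : RB).
    apply: continuous_measurable_fun => x.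
    by apply: cvgM; [apply: cvgB; [exact: cvg_id|exact: cvg_cst]|exact: cvg_cst].
  apply: measurable_funD; last exact: measurable_cst.
  apply: measurable_funD; apply: measurable_funM; try exact: measurable_cst.
  - exact: mt.
  - exact: (measurableT_comp mf mt).
- exact: measurable_cst.
Qed.

Lemma contractive_fixed_unique (p : \bar R) a c d beta f g : (1 <= p)%E ->
  contractive p (similarity_op a c d beta) ->
  is_fixed_point p (similarity_op a c d beta) f ->
  is_fixed_point p (similarity_op a c d beta) g ->
  {ae lebesgue01 R, forall x, f x = g x}.
Proof.
move=> p1 [q q1 Gq] [fp Gf] [gp Gg].
have p0 : (0 < p)%E by exact: lt_le_trans p1.
have mf : measurable_fun setT (f : RB -> RB) by move: fp; rewrite inE/= => /andP[/[!inE]].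
have mg : measurable_fun setT (g : RB -> RB) by move: gp; rewrite inE/= => /andP[/[!inE]].
have mfg : measurable_fun setT (f \- g : RB -> RB) by exact: measurable_funB.
have fgp : f \- g \in Lfun (lebesgue01 R) p.
  have Ngp := @Lfun_oppr_closed _ _ _ (lebesgue01 R) p _ gp.
  exact: (@Lfun_addr_closed _ _ _ (lebesgue01 R) p p1).2 _ _ fp Ngp.
have mGfg : measurable_fun setT
    (similarity_op a c d beta f \- similarity_op a c d beta g : RB -> RB).
  by apply: measurable_funB; exact: measurable_similarity_op.
have NE : ('N[lebesgue01 R]_p[EFin \o
      (similarity_op a c d beta f \- similarity_op a c d beta g)%R]
    = 'N[lebesgue01 R]_p[EFin \o (f \- g)%R])%E.
  by apply: ae_eq_Lnorm => //; [exact: ltW|apply: filterS2 Gf Gg => x /= -> ->].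
(* By [NE], contractivity bounds the norm [r] of [f \- g] by [q * r] with [q < 1]; as [r] is finite
   and nonnegative, it vanishes. *)
have N0 : ('N[lebesgue01 R]_p[EFin \o (f \- g)%R] = 0)%E.
  have Nfin : ('N[lebesgue01 R]_p[EFin \o (f \- g)%R] < +oo)%E.
    by move: fgp; rewrite inE/= => /andP[_ /[!inE]].
  move: (Gq f g fp gp) Nfin (Lnorm_ge0 (lebesgue01 R) p (EFin \o (f \- g)%R)).
  rewrite NE; case: ('N[lebesgue01 R]_p[EFin \o (f \- g)%R])%E => // r.
  rewrite -EFinM !lee_fin => rq _ r0; congr EFin; apply/eqP.
  by rewrite eq_le r0 andbT; nra.
have mE : measurable_fun setT (EFin \o (f \- g) : RB -> \bar R) by exact/measurable_EFinP.
have := Lnorm_eq0_eq0 mE p0 N0.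
by apply: filterS => x /(_ I) [] /eqP; rewrite subr_eq0 => /eqP.
Qed.

End Uniqueness.

(** * Both directions of the criterion *)

Section MainTheorem.
Context {R : realType} {n : nat} (a c d beta : 'I_n -> R).
Hypotheses (a_gt0 : forall k, 0 < a k) (a_sum1 : \sum_(k < n) a k = 1).

(** The images of the constants [1] and [0], at distance [1], differ by exactly [d k] on the [k]-th
    interval. That interval has positive length, so the essential bound [q] is attained as a
    pointwise bound somewhere in it. *)
Lemma contractive_oo_lt1 : contractive +oo%E (similarity_op a c d beta) ->
  forall k, `|d k| < 1.
Proof.
move=> [q q1 Gq] k; apply: le_lt_trans q1.
have cstL (r : R) : (cst r : R -> R) \in Lfun (lebesgue01 R) +oo%E.
  by apply: (@Lfun_bounded01 _ _ _ `|r|) => //; exact: leey.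
have := Gq _ _ (cstL 1) (cstL 0).
have mT : lebesgue01 R [set: measurableTypeR R] = 1%E.
  by rewrite /lebesgue01 /= /mrestr setTI lebesgue_measure_itv/= lte_fin ltr01 oppr0 adde0.
rewrite unlock /Lnorm mT lte01.
rewrite (_ : abse \o (EFin \o (cst 1 \- cst 0)%R) = cst 1%E); last first.
  by apply/funext => x; rewrite /= subr0 normr1.
rewrite ess_sup_cst ?mT// mule1 => h.
have dq := elimT ess_supP h.
have [x [xk]] : exists x, alpha a k < x < alpha a k.+1 /\ ((abse \o (EFin \o
    (similarity_op a c d beta (cst 1) \- similarity_op a c d beta (cst 0))%R)) x <= q%:E)%E.
  apply: ae_lebesgue01_dense dq.
  - exact: alpha_ge0.
  - by rewrite alphaS ltrDl.
  - by rewrite alphaS addrC alphaS_le1.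
rewrite /= lee_fin; apply: le_trans.
have ak := a_gt0 k.
have xE : x = a k * ((x - alpha a k) / a k) + alpha a k by field; rewrite gt_eqF.
have t01 : 0 < (x - alpha a k) / a k < 1.
  by rewrite ltr_pdivlMr// ltr_pdivrMr// mul0r mul1r; move: xk; rewrite alphaS; lra.
rewrite xE !similarity_op_affine//.
by rewrite mulr1 mulr0 addr0 opprD addrACA subrr addr0 addrAC subrr add0r.
Qed.

(** A second index takes a positive share of the total [1]; hence the iterated branch maps really
    shrink [[0, 1]]. *)
Lemma a_lt1 : (1 < n)%N -> forall k, a k < 1.
Proof.
move=> n1 k; have [j jk] : exists j : 'I_n, j != k.
  have [k0|k0] := posnP k.
    by exists (Ordinal n1); rewrite -(inj_eq val_inj)/= k0.
  by exists (Ordinal (ltnW n1)); rewrite -(inj_eq val_inj)/= eq_sym -lt0n.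
rewrite -a_sum1 (bigD1 k)//= ltrDl (bigD1 j)//= ltr_pwDl//.
by apply: sumr_ge0 => i _; exact: ltW.
Qed.

Lemma continuous_representative_clamp (f g : R -> R) :
  continuous_representative f g ->
  continuous (g \o clamp01) /\ {ae lebesgue01 R, forall x, f x = (g \o clamp01) x}.
Proof.
move=> [cg fg]; split; first exact: continuous_comp_clamp01.
have := @ae_lebesgue01_mem R; move: fg; apply: filterS2 => x -> x01.
by rewrite /= clamp01_id.
Qed.

Lemma continuous_fixed_necessary (p : \bar R) (f g : R -> R) : (1 < n)%N ->
  contractive p (similarity_op a c d beta) ->
  is_fixed_point p (similarity_op a c d beta) f ->
  (p = +oo%E \/ ~ is_affine f) ->
  continuous g -> {ae lebesgue01 R, forall x, f x = g x} ->
  (forall k, `|d k| < 1) /\ endpoint_equations c d beta (g 0) (g 1).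
Proof.
move=> n1 Gp [_ Gf] pf cg fg.
have gE := continuous_fixed_affine a_gt0 a_sum1 Gf cg fg.
split; last by apply: endpoint_equations_affine gE => //; exact: ltnW.
move=> k; case: pf => [poo|nf]; first by rewrite poo in Gp; exact: contractive_oo_lt1.
rewrite ltNge; apply/negP => dk; apply: nf.
exists (g 1 - g 0), (g 0).
have := @ae_lebesgue01_mem R; move: fg; apply: filterS2 => x -> x01.
apply: affine_of_scaling_ge1 (gE k) dk x x01 => //.
- exact: a_lt1.
- exact: alpha_ge0.
- exact: alphaS_le1.
Qed.

Lemma continuous_fixed_sufficient (p : \bar R) (f : R -> R) f0 f1 : (1 <= p)%E ->
  contractive p (similarity_op a c d beta) ->
  is_fixed_point p (similarity_op a c d beta) f ->
  (forall k, `|d k| < 1) -> endpoint_equations c d beta f0 f1 ->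
  exists g : R -> R, [/\ continuous g, g 0 = f0, g 1 = f1 &
    {ae lebesgue01 R, forall x, f x = g x}].
Proof.
move=> p1 Gp ff d1 eqs.
have [g [cg [M gM] g0 g1 Gg]] := exists_continuous_fixed a_gt0 a_sum1 eqs d1.
exists g; split => //; apply: contractive_fixed_unique ff _ => //; split => //.
by apply: Lfun_bounded01 gM => //; exact: continuous_measurable_fun.
Qed.

End MainTheorem.

Theorem mainTheorem7 (R : realType) (n : nat) (a c d beta : 'I_n -> R)
    (p : \bar R) (f : R -> R)
    (n_gt1 : (1 < n)%N)
    (a_gt0 : forall k, 0 < a k) (a_sum1 : \sum_(k < n) a k = 1)
    (p_ge1 : (1 <= p)%E)
    (G_contractive : contractive p (similarity_op a c d beta))
    (f_fixed : is_fixed_point p (similarity_op a c d beta) f)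
    (f_nondegenerate : p = +oo%E \/ ~ is_affine f) :
  ((exists g : R -> R, continuous_representative f g) <->
     \big[Num.max/0]_(k < n) `|d k| < 1 /\
     exists f0 f1 : R, endpoint_equations c d beta f0 f1) /\
  (forall (g : R -> R) (f0 f1 : R), continuous_representative f g ->
     endpoint_equations c d beta f0 f1 -> f0 = g 0 /\ f1 = g 1).
Proof.
have sufficient := continuous_fixed_sufficient a_gt0 a_sum1 p_ge1 G_contractive f_fixed.
have necessary := continuous_fixed_necessary a_gt0 a_sum1 n_gt1 G_contractive f_fixed
  f_nondegenerate.
split; [split|].
- move=> [g /continuous_representative_clamp [cg fg]].
  have [d1 eqs] := necessary _ cg fg.
  by split; [exact: bigmax_lt|exists (g (clamp01 0)), (g (clamp01 1))].
- move=> [/bigmax_ltP [_ d1] [f0 [f1 eqs]]].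
  have [|g [cg _ _ fg]] := sufficient _ _ _ eqs; first by move=> k; exact: d1.
  by exists g; split => //; exact: continuous_subspaceT.
(* Any solution [f0], [f1] of the equations produces a continuous representative [h] with these
   endpoint values. It agrees with [g] almost everywhere, hence on all of [[0, 1]]. *)
- move=> g f0 f1 /continuous_representative_clamp [cg fg] eqs.
  have [d1 _] := necessary _ cg fg.
  have [h [ch <- <- fh]] := sufficient _ _ d1 eqs.
  have gh : forall x, 0 <= x <= 1 -> h x = g x.
    move=> x x01; rewrite -[in RHS](clamp01_id x01).
    apply: (continuous_ae_eq01 ch cg _ x01).
    by apply: filterS2 fh fg => y -> ->.
  by split; apply: gh; rewrite lexx ler01.
Qed.
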